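(* Let $(X,d)$ be a locally compact metric space. Let $h$ be a Hausdorff function with $\lim_{t\to0}h(t)=0$. Let $Y$ be any non-empty length-compact metric space. Suppose that $P\subset X$ is a non-empty perfect set. Then there exist a compact, perfect set $P'\subset P$ and a continuous surjection $f\colon X\to Y$ such that $\mathcal{H}^h(P')=0$ and $f(P')=Y$.
   Context: A set in a topological space is perfect if it is closed and each open set that meets it at all meets it in an infinite set. A metric space $Y$ is length-compact if it is compact with respect to its path metric, where the path distance of two points is the infimum of the lengths of paths in $Y$ joining them; here the path metric is understood to be a genuine (finite-valued) metric, i.e. any two points of $Y$ are joined by a path of finite length. A Hausdorff function is a function $h\colon[0,\infty)\to[0,\infty)$ that is non-decreasing, continuous from the right, with $h(t)>0$ for $t>0$. $\mathcal{H}^h(E)=\sup_{\delta>0}\mathcal{H}^h_\delta(E)$, where $\mathcal{H}^h_\delta(E)$ is the infimum of $\sum_{i=1}^\infty h(\operatorname{diam}U_i)$ over all countable covers $(U_i)_i$ of $E$ with $\operatorname{diam}U_i\le\delta$ (empty $U_i$ contribute $0$, and $\inf\emptyset=\infty$). *)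

(* Defs.v *)
From HB Require Import structures.
From mathcomp Require Import all_boot all_order all_algebra.
From mathcomp Require Import all_classical all_reals all_analysis.

Set Implicit Arguments.
Unset Strict Implicit.
Unset Printing Implicit Defensive.

Import Order.TTheory GRing.Theory Num.Theory.
Import numFieldNormedType.Exports.

Local Open Scope classical_set_scope.
Local Open Scope ring_scope.

(* In a T1 space this is equivalent to the library's perfect_set, which is
   stated with limit points instead of infinite traces. *)
Definition perfect (T : topologicalType) (A : set T) : Prop :=
  closed A /\
  forall U : set T, open U -> U `&` A !=set0 -> infinite_set (U `&` A).

Section paths.
Context {R : realType} {Y : metricType R}.
Implicit Types (a b c d : R) (g : R -> Y) (s : seq R) (x y z : Y).

(* For s = [:: t_1; ...; t_n] and t_0 = a, zip (a :: s) s lists the pairs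
   (t_i, t_(i+1)), so this is the sum of the distances g t_i, g t_(i+1). *)
Definition polygonal_length g a s : R :=
  \sum_(p <- zip (a :: s) s) mdist (g p.1) (g p.2).

(* itv_partition a b s means a < t_1 < ... < t_n = b. *)
Definition path_length a b g : \bar R :=
  ereal_sup [set (polygonal_length g a s)%:E | s in itv_partition a b].

Definition joins x y a b g : Prop :=
  [/\ a <= b, {within `[a, b], continuous g}, g a = x & g b = y].

Definition path_edist x y : \bar R :=
  ereal_inf [set l | exists a b g, joins x y a b g /\ l = path_length a b g].

Definition path_dist x y : R := fine (path_edist x y).

End paths.

Definition rectifiably_connected {R : realType} (Y : metricType R) : Prop :=
  forall x y : Y, exists (a b : R) (g : R -> Y),
    joins x y a b g /\ (path_length a b g < +oo)%E.

Section path_dist_theory.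
Context {R : realType} {Y : metricType R}.
Implicit Types (a b c d : R) (g : R -> Y) (s : seq R) (x y z : Y).
Local Notation pl := polygonal_length.

Lemma polygonal_length_nil g a : pl g a [::] = 0.
Proof. by rewrite /pl big_nil. Qed.

Lemma polygonal_length_cons g a t s :
  pl g a (t :: s) = mdist (g a) (g t) + pl g t s.
Proof. by rewrite /pl /= big_cons. Qed.

Lemma polygonal_length_ge0 g a s : 0 <= pl g a s.
Proof. by apply: sumr_ge0 => p _; exact: mdist_ge0. Qed.

Lemma polygonal_length_rcons g a s t :
  pl g a (rcons s t) = pl g a s + mdist (g (last a s)) (g t).
Proof.
elim: s a => [|u s IH] a /=.
  by rewrite polygonal_length_cons !polygonal_length_nil addrC.
by rewrite !polygonal_length_cons IH addrA.
Qed.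

Lemma path_length_ge a b g s :
  itv_partition a b s -> ((pl g a s)%:E <= path_length a b g)%E.
Proof. by move=> abs; apply: ereal_sup_ubound; exists s. Qed.

Lemma path_length_ge0 a b g : a <= b -> (0 <= path_length a b g)%E.
Proof.
rewrite le_eqVlt => /predU1P[->|ab].
  apply: le_trans (path_length_ge g (s := [::]) _); last by split.
  by rewrite polygonal_length_nil.
apply: le_trans (path_length_ge g (s := [:: b]) _).
  by rewrite lee_fin polygonal_length_ge0.
exact: itv_partition1.
Qed.

Lemma mdist_le_path_length x y a b g :
  joins x y a b g -> ((mdist x y)%:E <= path_length a b g)%E.
Proof.
move=> [ab _ <- <-]; move: ab; rewrite le_eqVlt => /predU1P[->|ab].
  by rewrite mdistxx path_length_ge0.
apply: le_trans (path_length_ge g (s := [:: b]) _).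
  by rewrite polygonal_length_cons polygonal_length_nil addr0.
exact: itv_partition1.
Qed.

Lemma mdist_le_path_edist x y : ((mdist x y)%:E <= path_edist x y)%E.
Proof.
apply: le_ereal_inf_tmp => _ [a [b [g [jg ->]]]].
exact: mdist_le_path_length jg.
Qed.

Lemma path_edist_ge0 x y : (0 <= path_edist x y)%E.
Proof. by apply: le_trans (mdist_le_path_edist x y); rewrite lee_fin mdist_ge0. Qed.

Lemma path_edistxx x : path_edist x x = 0%E.
Proof.
apply/eqP; rewrite eq_le path_edist_ge0 andbT.
apply: ereal_inf_lbound; exists 0, 0, (cst x); split.
  by split => //; apply: continuous_subspaceT => t; exact: cvg_cst.
apply/eqP; rewrite eq_le path_length_ge0//=.
apply: ge_ereal_sup => _ [s /itv_partitionxx -> <-].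
by rewrite polygonal_length_nil.
Qed.

Let rev_partition (s : seq R) a := rev [seq - t | t <- belast a s].

Let last_rev_partition s a : last (- last a s) (rev_partition s a) = - a.
Proof.
by case: s => [|t s]//=; rewrite /rev_partition/= rev_cons last_rcons.
Qed.

Let path_rev_partition s a :
  path <%O a s -> path <%O (- last a s) (rev_partition s a).
Proof.
elim: s a => [|t s IH] a //= /andP[ta ts].
rewrite /rev_partition/= rev_cons rcons_path IH//=.
by rewrite -/(rev_partition s t) last_rev_partition ltrN2.
Qed.

Let polygonal_length_rev g s a :
  pl (g \o -%R) (- last a s) (rev_partition s a) = pl g a s.
Proof.
elim: s a => [|t s IH] a //=.
  by rewrite /rev_partition/= !polygonal_length_nil.
rewrite /rev_partition/= rev_cons polygonal_length_rcons.
rewrite -/(rev_partition s t) IH last_rev_partition polygonal_length_cons.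
by rewrite addrC /= !opprK metric_sym.
Qed.

Let path_length_rev a b g :
  (path_length (- b) (- a) (g \o -%R) <= path_length a b g)%E.
Proof.
apply: ge_ereal_sup => _ [s [ps /eqP ls] <-].
have -> : pl (g \o -%R) (- b) s = pl g a (rev_partition s (- b)).
  rewrite -(polygonal_length_rev (g \o -%R)) ls opprK; congr (pl _ _ _).
  by apply/funext => t /=; rewrite opprK.
apply: path_length_ge; split.
  by have := path_rev_partition ps; rewrite ls opprK.
by have := last_rev_partition s (- b); rewrite ls !opprK => ->.
Qed.

Let joins_rev x y a b g : joins x y a b g -> joins y x (- b) (- a) (g \o -%R).
Proof.
move=> [ab cg gx gy]; split => /=; rewrite ?lerN2 ?opprK//.
apply/subspace_continuousP => t tab.
have tab' : `[a, b]%classic (- t) by move: tab; rewrite /= !in_itv/= lerNl lerNr andbC.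
move/subspace_continuousP : cg => /(_ _ tab') cg.
apply: (@cvg_comp _ _ _ _ _ _ (within `[a, b] (nbhs (- t)))); last exact: cg.
move=> A; rewrite /within /= => /= nA.
change (nbhs t (fun u => `[- b, - a]%classic u -> A (- u))).
have nA' : nbhs t (fun u : R => `[a, b]%classic (- u) -> A (- u)).
  exact: (@oppr_continuous R R^o t _ nA).
apply: filterS nA' => u /= + uab; apply.
by move: uab; rewrite /= !in_itv/= lerNl lerNr andbC.
Qed.

Lemma path_edist_sym x y : path_edist x y = path_edist y x.
Proof.
suff H : forall u v : Y, (path_edist u v <= path_edist v u)%E.
  by apply/eqP; rewrite eq_le !H.
move=> u v; apply: le_ereal_inf_tmp => _ [a [b [g [jg ->]]]].
apply: le_trans (path_length_rev a b g); apply: ereal_inf_lbound.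
by exists (- b), (- a), (g \o -%R); split => //; exact: joins_rev.
Qed.

Let partition_split b g s a : a <= b -> b <= last a s -> path <%O a s ->
  exists s1 s2, [/\ itv_partition a b s1, itv_partition b (last a s) s2 &
    pl g a s <= pl g a s1 + pl g b s2].
Proof.
elim: s a => [|t s IH] a /=.
  move=> ab ba _; have -> : a = b by apply/eqP; rewrite eq_le ab.
  exists [::], [::]; split; [by split|by split|].
  by rewrite !polygonal_length_nil addr0.
move=> ab bl /andP[at_ ps]; have [tb|bt] := leP t b.
  have [s1 [s2 [[p1 l1] p2 le12]]] := IH t tb bl ps.
  exists (t :: s1), s2; split => //; first by split => //=; rewrite at_.
  by rewrite !polygonal_length_cons -addrA lerD2l.
have p2 : itv_partition b (last t s) (t :: s) by split => //=; rewrite bt.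
move: ab; rewrite le_eqVlt => /predU1P[->|ab].
  exists [::], (t :: s); split => //.
  by rewrite polygonal_length_nil add0r.
exists [:: b], (t :: s); split => //; first exact: itv_partition1.
rewrite !polygonal_length_cons polygonal_length_nil addr0 addrA lerD2r.
exact: metric_triangle.
Qed.

Let glue b c g1 g2 : R -> Y := fun t => if t <= b then g1 t else g2 (t - b + c).

Let path_shift b c s t :
  path <%O t s -> path <%O (t - b + c) [seq u - b + c | u <- s].
Proof.
elim: s t => [//|u s IH] t /= /andP[tu us].
by rewrite IH// andbT !ltrD2r.
Qed.

Let polygonal_length_glue_l b c g1 g2 s a : a <= b -> path <%O a s ->
  last a s <= b -> pl (glue b c g1 g2) a s = pl g1 a s.
Proof.
elim: s a => [|t s IH] a ab /=; first by rewrite !polygonal_length_nil.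
move=> /andP[at_ ts] lb; have tl : t <= last t s.
  by apply: (@itv_partition_le _ _ t _ s); split.
have tb : t <= b := le_trans tl lb.
by rewrite !polygonal_length_cons IH// /glue ab tb.
Qed.

Let polygonal_length_glue_r b c g1 g2 s t : g1 b = g2 c -> b <= t ->
  path <%O t s ->
  pl (glue b c g1 g2) t s = pl g2 (t - b + c) [seq u - b + c | u <- s].
Proof.
move=> g12; have gE u : b <= u -> glue b c g1 g2 u = g2 (u - b + c).
  rewrite /glue; case: (ltgtP u b) => // -> _.
  by rewrite subrr add0r.
elim: s t => [|u s IH] t bt /=; first by rewrite !polygonal_length_nil.
move=> /andP[tu us]; have bu : b <= u := le_trans bt (ltW tu).
by rewrite !polygonal_length_cons IH// !gE.
Qed.

Let joins_glue x y z a b c d g1 g2 : joins x y a b g1 -> joins y z c d g2 ->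
  joins x z a (b + (d - c)) (glue b c g1 g2).
Proof.
move=> [ab c1 <- g1b] [cd c2 g2c <-].
have g12 : g1 b = g2 c by rewrite g1b g2c.
have bd : b <= b + (d - c) by rewrite lerDl subr_ge0.
have gE u : b <= u -> glue b c g1 g2 u = g2 (u - b + c).
  rewrite /glue; case: (ltgtP u b) => // -> _.
  by rewrite subrr add0r.
split; [exact: le_trans bd| |by rewrite /glue ab|]; last first.
  by rewrite gE// [b + _]addrC addrK subrK.
have -> : [set` `[a, b + (d - c)]] =
    [set` `[a, b]] `|` [set` `[b, b + (d - c)]].
  apply/seteqP; split => t /=; rewrite !in_itv/=.
    move=> /andP[at_ tb]; case: (leP t b) => tb'.
      by left; rewrite at_.
    by right; rewrite tb (ltW tb').
  move=> [|] /andP[h1 h2]; first by rewrite h1 (le_trans h2).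
  by rewrite (le_trans ab).
apply: withinU_continuous; [exact: interval_closed|exact: interval_closed| |].
  apply: (@subspace_eq_continuous _ _ _ g1) c1 => t.
  by rewrite inE/= in_itv/= => /andP[_ tb]; rewrite /from_subspace /glue tb.
apply: (@subspace_eq_continuous _ _ _ (fun t => g2 (t - b + c))).
  by move=> t; rewrite inE/= in_itv/= => /andP[bt _]; rewrite /from_subspace gE.
have shiftP (t : R) : `[b, b + (d - c)]%classic t -> `[c, d]%classic (t - b + c).
  rewrite /= !in_itv/= => /andP[h1 h2].
  by rewrite lerDr subr_ge0 h1/= -lerBrDr lerBlDl.
apply/subspace_continuousP => t tab.
move/subspace_continuousP : c2 => /(_ _ (shiftP _ tab)) c2.
apply: (@cvg_comp _ _ _ _ _ _ (within `[c, d] (nbhs (t - b + c)))); last exact: c2.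
move=> A; rewrite /within /= => nA.
have sc : (fun u : R => u - b + c) @ t --> t - b + c.
  by apply: cvgD; [apply: cvgB; [exact: cvg_id|exact: cvg_cst]|exact: cvg_cst].
change (nbhs t (fun u => `[b, b + (d - c)]%classic u -> A (u - b + c))).
have nA' : nbhs t (fun u : R => `[c, d]%classic (u - b + c) -> A (u - b + c)).
  exact: (sc _ nA).
by apply: filterS nA' => u /= + uab; apply; exact: shiftP.
Qed.

Let path_length_glue a b c d g1 g2 : a <= b -> c <= d -> g1 b = g2 c ->
  (path_length a (b + (d - c))%R (glue b c g1 g2) <=
   path_length a b g1 + path_length c d g2)%E.
Proof.
move=> ab cd g12; apply: ge_ereal_sup => _ [s [ps /eqP ls] <-].
have bl : b <= last a s by rewrite ls lerDl subr_ge0.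
have [s1 [s2 [p1 p2 le12]]] := partition_split (glue b c g1 g2) ab bl ps.
apply: (@le_trans _ _ (pl (glue b c g1 g2) a s1 + pl (glue b c g1 g2) b s2)%:E).
  by rewrite lee_fin.
rewrite EFinD; apply: leeD.
  case: (p1) => p1p /eqP p1l.
  by rewrite polygonal_length_glue_l ?p1l//; exact: path_length_ge.
case: p2 => p2p /eqP p2l; rewrite polygonal_length_glue_r//.
rewrite subrr add0r; apply: path_length_ge; split.
  by have := path_shift b c p2p; rewrite subrr add0r.
have := last_map (fun u => u - b + c) s2 b; rewrite subrr add0r => ->.
by rewrite p2l ls [b + _]addrC addrK subrK.
Qed.

Context (Yrc : rectifiably_connected Y).

Lemma path_edist_fin_num x y : path_edist x y \is a fin_num.
Proof.
rewrite ge0_fin_numE ?path_edist_ge0//; have [a [b [g [jg]]]] := Yrc x y.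
by apply: le_lt_trans; apply: ereal_inf_lbound; exists a, b, g.
Qed.

Lemma path_edist_triangle y x z :
  (path_edist x z <= path_edist x y + path_edist y z)%E.
Proof.
apply/lee_addgt0Pr => e e0; have e20 : 0 < e / 2 by rewrite divr_gt0.
have [_ [a [b [g1 [j1 ->]]]] l1] :=
  lb_ereal_inf_adherent e20 (path_edist_fin_num x y).
have [_ [c [d [g2 [j2 ->]]]] l2] :=
  lb_ereal_inf_adherent e20 (path_edist_fin_num y z).
apply: (@le_trans _ _ (path_length a b g1 + path_length c d g2)%E).
  apply: (@le_trans _ _ (path_length a (b + (d - c)) (glue b c g1 g2))).
    apply: ereal_inf_lbound.
    exists a, (b + (d - c)), (glue b c g1 g2); split => //.
    exact: joins_glue j1 j2.
  case: j1 j2 => [ab _ _ g1b] [cd _ g2c _].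
  by apply: path_length_glue => //; rewrite g1b g2c.
rewrite [e in leRHS]splitr EFinD addeACA.
by apply: leeD; exact: ltW.
Qed.

Lemma path_distxx x : path_dist x x = 0.
Proof. by rewrite /path_dist path_edistxx. Qed.

Lemma path_dist_positivity x y : path_dist x y = 0 -> x = y.
Proof.
move=> xy0; apply: (@mdist_positivity R); apply/eqP.
rewrite eq_le mdist_ge0 andbT -lee_fin.
rewrite -xy0 /path_dist fineK ?path_edist_fin_num//.
exact: mdist_le_path_edist.
Qed.

Lemma path_dist_sym x y : path_dist x y = path_dist y x.
Proof. by rewrite /path_dist path_edist_sym. Qed.

Lemma path_dist_triangle y x z :
  path_dist x z <= path_dist x y + path_dist y z.
Proof.
rewrite /path_dist -fineD ?path_edist_fin_num// fine_le ?path_edist_fin_num//.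
  by rewrite fin_numD !path_edist_fin_num.
exact: path_edist_triangle.
Qed.

End path_dist_theory.

(* The carrier of Y, equipped with the path metric instead of its own one; the
   hypothesis makes the path metric finite-valued. *)
Definition path_metric_space {R : realType} (Y : metricType R)
  (Yrc : rectifiably_connected Y) : Type := Y.

Section path_metric_space.
Context {R : realType} {Y : metricType R} (Yrc : rectifiably_connected Y).

HB.instance Definition _ := Choice.on (path_metric_space Yrc).

HB.instance Definition _ := @isMetric.Build R (path_metric_space Yrc)
  (@path_dist R Y) (@path_distxx R Y) (path_dist_positivity Yrc)
  (@path_dist_sym R Y) (path_dist_triangle Yrc).

Lemma mdist_path_metric_space (x y : path_metric_space Yrc) :
  mdist x y = path_dist (x : Y) (y : Y).
Proof. by []. Qed.

End path_metric_space.

Definition length_compact {R : realType} (Y : metricType R) : Prop :=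
  exists Yrc : rectifiably_connected Y, compact [set: path_metric_space Yrc].

(* A function on [0, +oo[ is represented by a function on R of which only the
   values at nonnegative reals matter. *)
Definition hausdorff_function {R : realType} (h : R -> R) : Prop :=
  [/\ forall t, 0 <= t -> 0 <= h t,
      forall s t, 0 <= s -> s <= t -> h s <= h t,
      forall t, 0 <= t -> h x @[x --> t^'+] --> h t &
      forall t, 0 < t -> 0 < h t].

Section hausdorff_measure.
Context {R : realType} {X : metricType R}.
Implicit Types (U E : set X) (h : R -> R).
Local Open Scope ereal_scope.

(* The maximum with 0 gives the empty set diameter 0 rather than -oo. *)
Definition diam U : \bar R :=
  maxe 0 (ereal_sup [set (mdist p.1 p.2)%:E | p in U `*` U]).

(* Only used for sets of finite diameter. *)
Definition cover_term h U : \bar R :=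
  if U == set0 then 0 else (h (fine (diam U)))%:E.

Definition delta_cover (delta : R) E : set (nat -> set X) :=
  [set U | E `<=` \bigcup_i U i /\ forall i, diam (U i) <= delta%:E].

Definition hausdorff_content h (delta : R) E : \bar R :=
  ereal_inf [set \sum_(0 <= i <oo) cover_term h (U i) | U in delta_cover delta E].

Definition hausdorff_measure h E : \bar R :=
  ereal_sup [set hausdorff_content h delta E | delta in [set d : R | (0 < d)%R]].

End hausdorff_measure.

(* Main.v *)
(** Inside P, a binary tree of nested balls with rapidly decreasing radii gives
    an embedded Cantor space P' with H^h(P') = 0. By Alexandroff-Hausdorff, Y
    with its path metric is a continuous image psi of the Cantor space. Embed
    the Cantor space in the real line as well, with image K: transported to K,
    psi extends to a curve gamma : R -> Y, by running through a path of length
    at most twice the path distance of its end values in each gap of K. The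
    homeomorphism P' -> K extends to g : X -> R by Tietze, and f = gamma o g. *)

Require Import Defs.
From HB Require Import structures.
From mathcomp Require Import all_boot all_order all_algebra.
From mathcomp Require Import all_classical all_reals all_analysis.
From mathcomp Require Import lra.

Set Implicit Arguments.
Unset Strict Implicit.
Unset Printing Implicit Defensive.

Import Order.TTheory GRing.Theory Num.Theory.
Import numFieldNormedType.Exports.

Local Open Scope classical_set_scope.
Local Open Scope ring_scope.

(** * Vanishing Hausdorff measure *)

Section hausdorff_null.
Context {R : realType} {X : metricType R}.
Implicit Types (U E : set X) (h : R -> R).

Lemma diam_ge0 U : (0 <= diam U)%E.
Proof. by rewrite /diam le_max lexx. Qed.

Lemma diam_le U (M : R) : 0 <= M ->
  (forall x y, U x -> U y -> mdist x y <= M) -> (diam U <= M%:E)%E.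
Proof.
move=> M0 UM; rewrite /diam ge_max lee_fin M0/=.
by apply: ge_ereal_sup => _ [[x y] [/= Ux Uy] <-]; rewrite lee_fin UM.
Qed.

Lemma cover_term_ge0 h U : (forall t, 0 <= t -> 0 <= h t) ->
  (0 <= cover_term h U)%E.
Proof.
move=> h0; rewrite /cover_term; case: ifP => // _.
by rewrite lee_fin h0// fine_ge0// diam_ge0.
Qed.

Lemma cover_term_le h U (M e : R) : 0 <= e ->
  (forall t, 0 <= t <= M -> h t <= e) -> (diam U <= M%:E)%E ->
  (cover_term h U <= e%:E)%E.
Proof.
move=> e0 he UM; rewrite /cover_term; case: ifP => _; rewrite lee_fin//.
have := diam_ge0 U; case: (diam U) UM => [d| |]//=.
by rewrite !lee_fin => dM d0; rewrite he// d0.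
Qed.

(** Finite covers suffice, since padding a list with empty sets adds nothing to the sum. The single
    bound [e] on diameters and sum is applied below both [delta] and the allowed error. *)
Lemma hausdorff_measure_null h E : (forall t, 0 <= t -> 0 <= h t) ->
  (forall e : R, 0 < e -> exists L : seq (set X),
    [/\ E `<=` \bigcup_(U in [set` L]) U,
        forall U, U \in L -> (diam U <= e%:E)%E &
        (\sum_(U <- L) cover_term h U <= e%:E)%E]) ->
  hausdorff_measure h E = 0%E.
Proof.
move=> h0 EL; apply/eqP; rewrite eq_le; apply/andP; split; last first.
  apply: (@le_trans _ _ (hausdorff_content h 1 E)).
    apply: le_ereal_inf_tmp => _ [U _ <-].
    by apply: nneseries_ge0 => n _ _; exact: cover_term_ge0.
  by apply: ereal_sup_ubound; exists 1 => /=.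
apply: ge_ereal_sup => _ [d /= d0 <-].
apply/lee_addgt0Pr => e e0; rewrite add0e.
have me0 : 0 < Num.min d e by rewrite lt_min d0.
have [L [EsubL Ld Le]] := EL _ me0.
have mind : ((Num.min d e)%:E <= d%:E)%E by rewrite lee_fin ge_min lexx.
have mine : ((Num.min d e)%:E <= e%:E)%E by rewrite lee_fin ge_min lexx orbT.
apply: le_trans (le_trans Le mine).
have ct0 : cover_term h (@set0 X) = 0%E by rewrite /cover_term eqxx.
apply: ereal_inf_lbound; exists (nth set0 L).
  split.
    move=> x /EsubL [U /= UL Ux]; exists (index U L) => //=.
    by rewrite nth_index.
  move=> i; have [iL|iL] := ltnP i (size L).
    by apply: le_trans mind; apply: Ld; exact: mem_nth.
  by rewrite nth_default// diam_le// ltW.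
rewrite (nneseries_split _ (size L)); last by move=> n _; exact: cover_term_ge0.
rewrite add0n eseries0 ?adde0.
  by rewrite (big_nth set0) .
by move=> i Li _; rewrite nth_default.
Qed.

End hausdorff_null.

(** * Cantor schemes of nested balls in a perfect set *)

Lemma cantor_space_nbhs_prefix (c : cantor_space) (n : nat) :
  nbhs c [set d : cantor_space | forall i, (i < n)%N -> d i = c i].
Proof.
elim: n => [|n IHn]; first by apply: filterS filterT.
have nc : nbhs c [set d : cantor_space | d n = c n].
  apply: (@proj_continuous _ (fun _ : nat => bool) n c [set c n]).
  exact: discrete_set1.
apply: filterS2 IHn nc => d /= dc dn i; rewrite ltnS leq_eqVlt.
by move=> /predU1P[->//|/dc].
Qed.

Section cantor_scheme.
Context {R : realType} {X : metricType R} (h : R -> R) (P : set X).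
Context (h_ge0 : forall t, 0 <= t -> 0 <= h t).
Context (h_small : forall e, 0 < e ->
  exists2 d, 0 < d & forall t, 0 <= t <= d -> h t <= e).
Context (P_closed : closed P).
Context (P_nonisolated : forall x e, P x -> 0 < e ->
  exists y, [/\ P y, y != x & mdist x y <= e]).
Implicit Types (c d : cantor_space) (n m : nat).

(* A node is the center and the radius of a closed ball. Its two children are
   the balls of radius w.2 around its own center v.1 and around w.1. *)
Definition cantor_child n (v w : X * R) :=
  [/\ P w.1, 0 < w.2 <= v.2 / 2, mdist v.1 w.1 <= v.2 / 2,
      2 * w.2 < mdist v.1 w.1 &
      forall t, 0 <= t <= 2 * w.2 -> h t <= 4 ^- n.+1].

Lemma cantor_child_ex : exists s : nat * (X * R) -> X * R,
  forall nv, P nv.2.1 -> 0 < nv.2.2 -> cantor_child nv.1 nv.2 (s nv).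
Proof.
suff : forall nv : nat * (X * R), exists w, P nv.2.1 -> 0 < nv.2.2 ->
  cantor_child nv.1 nv.2 w by move=> /choice[s sP]; exists s.
move=> -[n [x r]] /=.
(* For a node outside the hypotheses any witness will do; totality lets [choice] produce [s]. *)
have [Px|nP] := pselect (P x); last by exists (x, r).
have [r0|nr] := pselect (0 < r); last by exists (x, r).
have r20 : 0 < r / 2 by rewrite divr_gt0.
have [y [Py yx dxy]] := P_nonisolated Px r20.
have dxy0 : 0 < mdist x y by rewrite mdist_gt0 eq_sym.
have e0 : 0 < (4 ^- n.+1 : R) by rewrite invr_gt0 exprn_gt0.
have [d d0 hd] := h_small e0.
(* The three bounds give the halving of the radii, the disjointness of the two children and the
   smallness of [h]; dividing by 3 rather than 2 makes the separation strict. *)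
pose r' := Num.min (r / 2) (Num.min (mdist x y / 3) (d / 2)).
have r'r : r' <= r / 2 by rewrite /r' ge_min lexx.
have r'y : r' <= mdist x y / 3 by rewrite /r' !ge_min lexx orbT.
have r'd : r' <= d / 2 by rewrite /r' !ge_min lexx !orbT.
have r'0 : 0 < r' by rewrite /r' !lt_min r20 !divr_gt0.
exists (y, r') => _ _; split => //=.
- by rewrite r'0.
- lra.
- by move=> t /andP[t0 tr]; apply: hd; rewrite t0/=; lra.
Qed.

Context (s : nat * (X * R) -> X * R).
Context (sP : forall nv, P nv.2.1 -> 0 < nv.2.2 -> cantor_child nv.1 nv.2 (s nv)).
Context (v0 : X * R) (v0P : P v0.1) (v0_gt0 : 0 < v0.2 <= 1).

Fixpoint cantor_node c n : X * R :=
  if n is m.+1 then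
    let w := s (m, cantor_node c m) in
    (if c m then w.1 else (cantor_node c m).1, w.2)
  else v0.

Local Notation node := cantor_node.

Lemma cantor_node_prefix c d n : (forall i, (i < n)%N -> c i = d i) ->
  node c n = node d n.
Proof.
elim: n => //= n IHn cd; rewrite cd// IHn// => i ilt; apply: cd.
by rewrite ltnS ltnW.
Qed.

Lemma cantor_nodeP c n : P (node c n).1 /\ 0 < (node c n).2 <= 2 ^- n.
Proof.
elim: n => [|n [IP /andP[I0 I1]]] /=; first by rewrite expr0 invr1.
have [Pw /andP[w0 wr] _ _ _] := sP (nv := (n, node c n)) IP I0.
split; first by case: ifP.
rewrite w0/= (le_trans wr)// exprS invfM mulrC.
by rewrite ler_pM2l ?invr_gt0.
Qed.

Lemma cantor_node_gt0 c n : 0 < (node c n).2.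
Proof. by have [_ /andP[]] := cantor_nodeP c n. Qed.

Lemma cantor_node_child c n :
  cantor_child n (node c n) (s (n, node c n)).
Proof.
by apply: (sP (nv := (n, node c n))); have [? /andP[]] := cantor_nodeP c n.
Qed.

(** Passing to a child moves the center by at most half the radius, and the child's radius is at
    most the other half; so later closed balls stay inside earlier ones. *)
Lemma cantor_node_nested c n k :
  mdist (node c n).1 (node c (n + k)).1 + (node c (n + k)).2 <= (node c n).2.
Proof.
elim: k => [|k IHk]; first by rewrite addn0 mdistxx add0r.
rewrite addnS; apply: le_trans IHk => /=.
have [_ /andP[w0 wr] dw _ _] := cantor_node_child c (n + k).
set v := node c (n + k) in w0 wr dw *; set w := s (_, v) in w0 wr dw *.
case: ifP => _.
  have := metric_triangle (node c n).1 v.1 w.1; lra.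
by rewrite lerD2l (le_trans wr)// ler_pdivrMr// ler_peMr// ?ler1n//; lra.
Qed.

Lemma cantor_node_h c n t : 0 <= t <= 2 * (node c n.+1).2 -> h t <= 4 ^- n.+1.
Proof. by move=> /=; have [_ _ _ _] := cantor_node_child c n; apply. Qed.

Context (K : set X) (cK : compact K) (v0K : ball v0.1 (2 * v0.2) `<=` K).

(** The centers along a branch stay in the compact [K]; a cluster point of them lies in [P] and in
    every ball of the branch, as these sets are closed. *)
Lemma cantor_point_ex c :
  exists z, P z /\ forall n, mdist (node c n).1 z <= (node c n).2.
Proof.
pose u n := (node c n).1.
have uK n : K (u n).
  apply: v0K; rewrite ballEmdist/=.
  have := cantor_node_nested c 0 n; rewrite add0n/= -/(u n).
  by have := cantor_node_gt0 c n; case/andP: v0_gt0; lra.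
have FK : (u @ \oo) K by exists 0%N => [//|n _]; exact: uK.
have [z [Kz clz]] := cK (fmap_proper_filter _ _) FK.
exists z; split.
  apply: P_closed => B nB; apply: clz nB; exists 0%N => [//|n _].
  by have [] := cantor_nodeP c n.
move=> n; apply/ler_addgt0Pr => e e0.
have nE : (u @ \oo) [set x | mdist (u n) x <= (node c n).2].
  exists n => // m /= nm; have := cantor_node_nested c n (m - n).
  rewrite subnKC// -/(u m) => H; have := cantor_node_gt0 c m.
  by rewrite /u in H *; lra.
have [x [/= unx]] := clz _ _ nE (nbhsx_ballx z _ e0).
rewrite ballEmdist/= metric_sym => xz.
have := metric_triangle (u n) x z; rewrite /u in unx *; lra.
Qed.

Context (e : cantor_space -> X).
Context (eP : forall c, P (e c) /\ forall n, mdist (node c n).1 (e c) <= (node c n).2).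

Lemma cantor_point_prefix c d n : (forall i, (i < n)%N -> c i = d i) ->
  mdist (e c) (e d) <= 2 * (node c n).2.
Proof.
move=> cd; have [_ /(_ n) ec] := eP c; have [_ /(_ n) ed] := eP d.
rewrite -(cantor_node_prefix cd) metric_sym in ed.
rewrite metric_sym in ec; rewrite metric_sym in ed.
have := metric_triangle (e c) (node c n).1 (e d); lra.
Qed.

Lemma cantor_radius_lt (r : R) : 0 < r ->
  exists n, [/\ (0 < n)%N, 2 ^- n <= r & forall c, 2 * (node c n).2 < r].
Proof.
move=> r0; have r20 : 0 < r / 2 by rewrite divr_gt0.
have [n _ /(_ n (leqnn n)) nr] : \forall n \near \oo, (2 ^- n : R) < r / 2.
  have /cvgrPdist_lt/(_ _ r20) : (fun n => geometric 1 (2^-1 : R) n) @ \oo --> (0 : R).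
    by apply: cvg_geometric; rewrite gtr0_norm ?invr_gt0// invf_lt1// ltr1n.
  apply: filterS => n; rewrite sub0r normrN /geometric/= mul1r exprVn.
  by rewrite gtr0_norm// invr_gt0 exprn_gt0.
have n20 : 0 < (2 ^- n : R) by rewrite invr_gt0 exprn_gt0.
(* The shift makes the index positive and absorbs the factor 2, as 2 * 2^-(n+1) = 2^-n. *)
exists n.+1; split => // [|c]; first by rewrite exprS invfM; lra.
have [_ /andP[_]] := cantor_nodeP c n.+1; rewrite exprS invfM; lra.
Qed.

Lemma cantor_point_continuous : continuous e.
Proof.
move=> c; apply/metricType_numDomainType.cvgrPdist_lt => r r0.
have [n [_ _ nr]] := cantor_radius_lt r0.
apply: filterS (cantor_space_nbhs_prefix c n) => d /= dc.
by apply: le_lt_trans (nr c); apply: cantor_point_prefix => i /dc.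
Qed.

(** At the first index where two branches differ, their points lie in balls of radius [w.2] around
    centers more than [2 * w.2] apart. *)
Lemma cantor_point_inj : injective e.
Proof.
move=> c d ecd; apply/funext => k; apply: contrapT => /eqP cdk.
have [n cdn nmin] := ex_minnP (ex_intro (fun k => c k != d k) k cdk).
have cd i : (i < n)%N -> c i = d i.
  by move=> ilt; apply/eqP/negPn/negP => /nmin; rewrite leqNgt ilt.
have [_ /(_ n.+1) ec] := eP c; have [_ /(_ n.+1) ed] := eP d.
have [_ _ _ +] := cantor_node_child c n.
move: ec ed; rewrite /= -ecd -(cantor_node_prefix cd).
set v := node c n; set w := s _; move: cdn.
have t1 := metric_triangle v.1 (e c) w.1.
have sw := metric_sym w.1 (e c).
by case: (c n) (d n) => -[]//= _; lra.
Qed.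

(** Compactness gives closedness; changing a single bit of [c] far out gives infinitely many
    distinct points of the range near [e c]. *)
Lemma cantor_range_perfect : perfect (range e).
Proof.
split.
  apply: compact_closed; first exact: metric_hausdorff.
  apply: continuous_compact; last exact: cantor_space_compact.
  exact/continuous_subspaceT/cantor_point_continuous.
move=> U oU [_ [/[swap] [[c _ <-]] Uec]].
have [r /= r0 rU] : exists2 r : R, 0 < r & ball (e c) r `<=` U.
  by apply/nbhs_ballP; exact: open_nbhs_nbhs.
have [n [_ _ nr]] := cantor_radius_lt r0.
pose flip k : cantor_space := fun i => if i == (n + k)%N then ~~ c i else c i.
have flipU k : (U `&` range e) (e (flip k)).
  split; last by exists (flip k).
  apply: rU; rewrite ballEmdist/=; apply: le_lt_trans (nr c).
  apply: cantor_point_prefix => i ilt; rewrite /flip ifF//.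
  by apply/negbTE; rewrite neq_ltn (leq_trans ilt)// leq_addr.
(* The flips are pairwise distinct, so a finite trace would make [nat] finite. *)
move=> finU; apply: infinite_nat.
have -> : [set: nat] = (e \o flip) @^-1` (U `&` range e).
  by apply/seteqP; split => k // _; exact: flipU.
apply: finite_preimage finU => k l _ _ /= /cantor_point_inj.
move=> /(congr1 (fun c : cantor_space => c (n + k)%N)); rewrite /flip eqxx.
by case: eqP => [/addnI//|_]; case: (c _).
Qed.

Lemma cantor_range_null : hausdorff_measure h (range e) = 0%E.
Proof.
apply: hausdorff_measure_null => // r r0.
have [[|n] []] := cantor_radius_lt r0 => // _ n2r nr.
(* [cyl t] collects the branches that begin with [t]; [pt t], which continues [t] by [false], is a
   representative that names their common node. *)
pose cyl (t : n.+1.-tuple bool) := [set c : cantor_space |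
  forall i, (i < n.+1)%N -> c i = nth false t i].
pose pt (t : n.+1.-tuple bool) : cantor_space := fun i => nth false t i.
have cylP t c : cyl t c -> node c n.+1 = node (pt t) n.+1.
  exact: cantor_node_prefix.
have diamP t : (diam (e @` cyl t) <= (2 * (node (pt t) n.+1).2)%:E)%E.
  apply: diam_le => [|_ _ [c ct <-] [d dt <-]].
    by rewrite mulr_ge0// ltW// cantor_node_gt0.
  rewrite -(cylP t c)//; apply: cantor_point_prefix => i ilt.
  by rewrite ct// dt.
exists [seq e @` cyl t | t <- enum {: n.+1.-tuple bool}]; split.
- move=> _ [c _ <-]; pose t := [tuple c i | i < n.+1].
  exists (e @` cyl t) => /=; first by apply: map_f; rewrite mem_enum.
  exists c => // i ilt; have := tnth_mktuple (fun i : 'I_n.+1 => c i) (Ordinal ilt).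
  by rewrite (tnth_nth false) => ->.
- move=> U /mapP[t _ ->]; apply: (le_trans (diamP t)).
  by rewrite lee_fin ltW.
rewrite big_map big_enum/=.
apply: (@le_trans _ _ (\sum_(t : n.+1.-tuple bool) (4 ^- n.+1)%:E)%E).
  apply: lee_sum => t _; apply: cover_term_le (diamP t).
    by rewrite invr_ge0 exprn_ge0.
  exact: cantor_node_h.
(* There are 2^(n+1) cylinders, and 2^(n+1) * 4^-(n+1) = 2^-(n+1). *)
rewrite sumEFin sumr_const card_tuple card_bool lee_fin -[leLHS]mulr_natr.
apply: le_trans n2r; rewrite natrX.
have -> : (4 : R) = 2 * 2 by rewrite -natrM.
by rewrite exprMn invfM mulfVK// expf_neq0.
Qed.

End cantor_scheme.

(* The image of the Cantor space is obtained from a binary tree of nested balls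
   whose radii decrease so fast that the 2^n balls of generation n have total
   h-content at most 2^-n. *)
Lemma cantor_embedding {R : realType} {X : metricType R} (h : R -> R)
    (P : set X) :
  locally_compact [set: X] ->
  (forall t, 0 <= t -> 0 <= h t) ->
  (forall e, 0 < e -> exists2 d, 0 < d & forall t, 0 <= t <= d -> h t <= e) ->
  P !=set0 -> closed P ->
  (forall x e, P x -> 0 < e -> exists y, [/\ P y, y != x & mdist x y <= e]) ->
  exists e : cantor_space -> X,
    [/\ continuous e, injective e, range e `<=` P, perfect (range e) &
        hausdorff_measure h (range e) = 0%E].
Proof.
move=> lcX h_ge0 h_small [p Pp] P_closed P_nonisolated.
have [K nK [cK _]] := lcX p I.
rewrite withinET in nK; move/nbhs_ballP : nK => [r /= r0 rK].
(* Halving [r] keeps the ball of radius [2 * r'], and with it all centers, inside [K]; the bound 1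
   starts the estimate of the radii by 2^-n. *)
pose r' := Num.min 1 (r / 2).
have r'r : r' <= r / 2 by rewrite /r' ge_min lexx orbT.
have r'01 : 0 < r' <= 1 by rewrite /r' lt_min ltr01 divr_gt0//= ge_min lexx.
have v0K : ball p (2 * r') `<=` K.
  by apply: subset_trans rK; apply: le_ball; lra.
have [s sP] := cantor_child_ex h_small P_nonisolated.
have /choice[e eP] := cantor_point_ex P_closed sP (v0 := (p, r')) Pp r'01 cK v0K.
exists e; split.
- exact: (cantor_point_continuous sP (v0 := (p, r')) Pp r'01 eP).
- exact: (cantor_point_inj sP (v0 := (p, r')) Pp r'01 eP).
- by move=> _ [c _ <-]; have [] := eP c.
- exact: (cantor_range_perfect sP (v0 := (p, r')) Pp r'01 eP).
- exact: (cantor_range_null h_ge0 sP (v0 := (p, r')) Pp r'01 eP).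
Qed.

(** * Short paths, and extension over the gaps of a compact set of reals *)

Lemma continuous_clamp {R : realType} (a b : R) :
  continuous (fun t : R => Num.max a (Num.min t b)).
Proof.
move=> t; apply: (@continuous_max R R^o (cst a) (fun t => Num.min t b)).
  exact: cst_continuous.
apply: (@continuous_min R R^o id (cst b)); first exact: cvg_id.
exact: cst_continuous.
Qed.

(** The infimum defining the path distance need not be attained; the factor 2 leaves room for an
    actual path when [y] and [z] differ, and a constant path serves otherwise. No point of a path is
    further from its start than the length. *)
Lemma short_path {R : realType} {Y : metricType R} :
  rectifiably_connected Y -> forall y z : Y, exists p : R -> Y,
    [/\ continuous p, p 0 = y, p 1 = z &
        forall t, mdist y (p t) <= 2 * path_dist y z].
Proof.
move=> Yrc y z; have [->|yz] := eqVneq y z.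
  exists (cst z); split => // [|t]; first exact: cst_continuous.
  by rewrite mdistxx mulr_ge0// fine_ge0// path_edist_ge0.
have D0 : 0 < path_dist y z.
  rewrite lt_neqAle fine_ge0 ?path_edist_ge0// andbT.
  by apply: contra yz => /eqP/esym/(path_dist_positivity Yrc)/eqP.
have [_ [a [b [g [[ab cg ga gb] ->]]]]] :=
  lb_ereal_inf_adherent D0 (path_edist_fin_num Yrc y z).
rewrite -/(path_edist y z) -(fineK (path_edist_fin_num Yrc y z)).
rewrite -/(path_dist y z) -EFinD => gD.
have ltab : a < b.
  by rewrite lt_neqAle ab andbT; apply: contra yz => /eqP abE; rewrite -ga -gb abE.
have gle u : a <= u <= b -> mdist y (g u) <= 2 * path_dist y z.
  move=> /andP[]; rewrite le_eqVlt => /predU1P[<- _|au ub].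
    by rewrite ga mdistxx mulr_ge0// ltW.
  rewrite -lee_fin mulrDl !mul1r; apply: le_trans (ltW gD).
  move: ub; rewrite le_eqVlt => /predU1P[->|ub].
    apply: le_trans (path_length_ge g (itv_partition1 ltab)).
    by rewrite polygonal_length_cons polygonal_length_nil addr0 ga.
  (* The distance from [y] to [g u] is the first term of the polygonal length for this partition. *)
  have abu : itv_partition a b [:: u; b] by split => //=; rewrite au ub.
  apply: le_trans (path_length_ge g abu).
  rewrite !polygonal_length_cons polygonal_length_nil addr0 ga lee_fin.
  by rewrite lerDl mdist_ge0.
(* The affine map from [0, 1] onto [a, b], clamped so that the path is continuous on the whole
   line. *)
pose cl t := Num.max a (Num.min (a + t * (b - a)) b).
have clab t : a <= cl t <= b.
  by rewrite /cl le_max lexx/= ge_max ab ge_min lexx orbT.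
have ccl : continuous cl.
  move=> t; apply: (@cvg_comp _ _ _ (fun t => a + t * (b - a))
    (fun t => Num.max a (Num.min t b))); last exact: continuous_clamp.
  apply: cvgD; first exact: cvg_cst.
  by apply: cvgM; [exact: cvg_id|exact: cvg_cst].
exists (g \o cl); split => [t| | |t] /=; last exact: gle.
- move/subspace_continuousP : cg => /(_ (cl t)); rewrite /= in_itv/=.
  move=> /(_ (clab t)) cg; apply: cvg_comp cg.
  move=> A nA; change (nbhs t (fun u => A (cl u))).
  have nA' : nbhs t (fun u => `[a, b]%classic (cl u) -> A (cl u)) by exact: (ccl t _ nA).
  by apply: filterS nA' => u /=; apply; rewrite in_itv/= clab.
- by rewrite /cl mul0r addr0 min_l// maxxx.
- by rewrite /cl mul1r subrKC minxx max_r.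
Qed.

Lemma closed_has_max {R : realType} (A : set R) :
  closed A -> A !=set0 -> has_ubound A -> exists2 x, A x & ubound A x.
Proof.
move=> cA A0 uA; exists (sup A); last exact: ub_le_sup.
exact/cA/closure_sup.
Qed.

Lemma closed_has_min {R : realType} (A : set R) :
  closed A -> A !=set0 -> has_lbound A -> exists2 x, A x & lbound A x.
Proof.
move=> cA [x Ax] [m mA].
have [|||y Ay yA] := @closed_has_max R (-%R @^-1` A).
- by apply: preimage_closed cA => u _; exact: (@oppr_continuous R R^o).
- by exists (- x); rewrite /= opprK.
- by exists (- m) => u /= /mA; rewrite lerNr.
exists (- y) => // u Au; rewrite lerNl; apply: yA => /=.
by rewrite opprK.
Qed.

(** The constant comes from d(x, a) + 2 d(a, b) < e/5 + 2 * (2e/5) = e, with d the path distance,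
    which dominates [mdist]. *)
Lemma path_dist_close {R : realType} {Y : metricType R} (x a b y : Y) (e : R) :
  rectifiably_connected Y -> path_dist x a < e / 5 -> path_dist x b < e / 5 ->
  mdist a y <= 2 * path_dist a b -> mdist x y < e.
Proof.
move=> Yrc; have := metric_triangle x a y.
have := path_dist_triangle Yrc x a b; rewrite (path_dist_sym a x).
have : mdist x a <= path_dist x a.
  by rewrite -lee_fin fineK ?path_edist_fin_num// mdist_le_path_edist.
lra.
Qed.

Section gap_filling.
Context {R : realType} {Y : metricType R} (Yrc : rectifiably_connected Y).
Context (K : set R) (phi : R -> path_metric_space Yrc).
Context (phi_cont : {within K, continuous phi}).
Context (pa : Y -> Y -> R -> Y) (paP : forall y z, [/\ continuous (pa y z),
  pa y z 0 = y, pa y z 1 = z & forall t, mdist y (pa y z t) <= 2 * path_dist y z]).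
Context (lo hi : R -> R).
Context (loP : forall t, [/\ K (lo t), lo t <= t &
  forall x, K x -> x <= t -> x <= lo t]).
Context (hiP : forall t, [/\ K (hi t), t <= hi t &
  forall x, K x -> t <= x -> hi t <= x]).

(* lo t = hi t for t in K; then the argument of the path is 0 / 0 = 0. *)
Definition fill_gaps t : Y :=
  pa (phi (lo t)) (phi (hi t)) ((t - lo t) / (hi t - lo t)).

Lemma lo_id t : K t -> lo t = t.
Proof.
by move=> Kt; have [_ tlo /(_ t Kt (lexx _)) lot] := loP t; apply/le_anti/andP.
Qed.

Lemma hi_id t : K t -> hi t = t.
Proof.
by move=> Kt; have [_ tlo /(_ t Kt (lexx _)) lot] := hiP t; apply/le_anti/andP.
Qed.

Lemma fill_gaps_id t : K t -> fill_gaps t = phi t.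
Proof.
move=> Kt; rewrite /fill_gaps lo_id// hi_id// subrr mul0r.
by have [] := paP (phi t) (phi t).
Qed.

(** The endpoints are included because the path takes the values of [phi] there; this yields
    one-sided continuity at the ends of a gap. *)
Lemma fill_gaps_on_gap a b t : a < b -> K a -> K b ->
  (forall x, K x -> a < x < b -> False) -> a <= t <= b ->
  fill_gaps t = pa (phi a) (phi b) ((t - a) / (b - a)).
Proof.
move=> ab Ka Kb gap /andP[].
have [_ p0 p1 _] := paP (phi a) (phi b).
rewrite le_eqVlt => /predU1P[<- _|lt_at].
  by rewrite fill_gaps_id// subrr mul0r p0.
rewrite le_eqVlt => /predU1P[->|tb].
  by rewrite fill_gaps_id// divff ?p1// subr_eq0 gt_eqF.
have [Kl lt /(_ _ Ka (ltW lt_at)) al] := loP t.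
have [Kh th /(_ _ Kb (ltW tb)) hb] := hiP t.
have <- : lo t = a.
  apply/le_anti/andP; split => //; rewrite leNgt; apply/negP => alt.
  by apply: (gap _ Kl); rewrite alt (le_lt_trans lt).
have <- // : hi t = b.
apply/le_anti/andP; split => //; rewrite leNgt; apply/negP => hlt.
by apply: (gap _ Kh); rewrite hlt (lt_le_trans lt_at).
Qed.

Lemma fill_gaps_gap_continuous a b x (e : R) : a < b -> K a -> K b ->
  (forall x, K x -> a < x < b -> False) -> a <= x <= b -> 0 < e ->
  \forall t \near x, a <= t <= b -> mdist (fill_gaps x) (fill_gaps t) < e.
Proof.
move=> ab Ka Kb gap xab e0; have [pc _ _ _] := paP (phi a) (phi b).
have cF : (fun t => pa (phi a) (phi b) ((t - a) / (b - a))) @ x -->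
    pa (phi a) (phi b) ((x - a) / (b - a)).
  apply: (@cvg_comp _ _ _ (fun t => (t - a) / (b - a)) (pa (phi a) (phi b))); last exact: pc.
  by apply: cvgM; [apply: cvgB; [exact: cvg_id|exact: cvg_cst]|exact: cvg_cst].
have /metricType_numDomainType.cvgrPdist_lt/(_ _ e0) := cF.
by apply: filterS => t /= + tab; rewrite !(fill_gaps_on_gap ab).
Qed.

(** Since [u <= lo t] and [hi t <= v], both neighbors of [t] in [K] are within [d] of [x]. Their
    images are then close to [phi x], and so is the path between them. *)
Lemma fill_gaps_near x (e : R) : K x -> 0 < e -> exists2 d, 0 < d &
  forall u v t, K u -> K v -> x - d < u -> v < x + d -> u <= t <= v ->
    mdist (fill_gaps x) (fill_gaps t) < e.
Proof.
move=> Kx e0; have e50 : 0 < e / 5 by rewrite divr_gt0.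
move/subspace_continuousP : phi_cont => /(_ _ Kx).
move=> /metricType_numDomainType.cvgrPdist_lt/(_ _ e50).
rewrite near_withinE => /nbhs_ballP[d /= d0 dphi].
have {}dphi u : K u -> x - d < u < x + d -> path_dist (phi x : Y) (phi u) < e / 5.
  move=> Ku /andP[? ?]; apply: dphi => //.
  by rewrite /ball/= ltr_norml; lra.
exists d => // u v t Ku Kv xu vx /andP[ut tv].
have [Kl lt /(_ _ Ku ut) ul] := loP t.
have [Kh th /(_ _ Kv tv) hv] := hiP t.
have xl : path_dist (phi x : Y) (phi (lo t)) < e / 5 by apply: dphi => //; lra.
have xh : path_dist (phi x : Y) (phi (hi t)) < e / 5 by apply: dphi => //; lra.
rewrite fill_gaps_id//; apply: (path_dist_close Yrc xl xh).
by have [_ _ _ +] := paP (phi (lo t)) (phi (hi t)); apply.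
Qed.

(** Near a point outside [K] only one path is involved. At a point of [K] the two sides are treated
    separately: either [K] has points closer than [d] on that side, or a gap begins at [x]. *)
Lemma fill_gaps_continuous : continuous fill_gaps.
Proof.
move=> x; apply/metricType_numDomainType.cvgrPdist_lt => e e0.
have [Kx|nKx] := pselect (K x); last first.
  have [Kl lx loM] := loP x; have [Kh xh hiM] := hiP x.
  have {}lx : lo x < x.
    by rewrite lt_neqAle lx andbT; apply/eqP => lxx; apply: nKx; rewrite -lxx.
  have {}xh : x < hi x.
    by rewrite lt_neqAle xh andbT; apply/eqP => lxx; apply: nKx; rewrite lxx.
  have gap y : K y -> lo x < y < hi x -> False.
    move=> Ky /andP[ly yh]; have [yx|/ltW xy] := leP y x.
      by have := loM _ Ky yx; rewrite leNgt ly.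
    by have := hiM _ Ky xy; rewrite leNgt yh.
  have xab : lo x <= x <= hi x by rewrite !ltW.
  have := fill_gaps_gap_continuous (lt_trans lx xh) Kl Kh gap xab e0.
  apply: filterS3 (lt_nbhsl xh) (lt_nbhsr lx) => t th lt; apply.
  by rewrite !ltW.
have [d d0 dP] := fill_gaps_near Kx e0.
have right : \forall t \near x, x <= t -> mdist (fill_gaps x) (fill_gaps t) < e.
  have [[v [Kv /andP[xv vx]]]|nv] := pselect (exists v, K v /\ x < v < x + d).
    apply: filterS (lt_nbhsl xv) => t tv xt.
    by apply: (dP x v) => //; [lra|rewrite xt ltW].
  (* With no point of [K] strictly between [x] and [x + d], the first one after [x + d / 2] is the
     far end of a gap starting at [x]. *)
  have [Kh xh hiM] := hiP (x + d / 2); set b := hi _ in Kh xh hiM.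
  have xb : x < b by lra.
  have gap y : K y -> x < y < b -> False.
    move=> Ky /andP[xy yb]; apply: nv; exists y; split => //; rewrite xy/=.
    rewrite ltNge; apply/negP => dy; have := hiM _ Ky; lra.
  have xab : x <= x <= b by rewrite lexx ltW.
  have := fill_gaps_gap_continuous xb Kx Kh gap xab e0.
  apply: filterS2 (lt_nbhsl xb) => t tb + xt; apply.
  by rewrite xt ltW.
have left : \forall t \near x, t <= x -> mdist (fill_gaps x) (fill_gaps t) < e.
  have [[v [Kv /andP[xv vx]]]|nv] := pselect (exists v, K v /\ x - d < v < x).
    apply: filterS (lt_nbhsr vx) => t tv xt.
    by apply: (dP v x) => //; [lra|rewrite xt ltW].
  have [Kh xh loM] := loP (x - d / 2); set a := lo _ in Kh xh loM.
  have ax : a < x by lra.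
  have gap y : K y -> a < y < x -> False.
    move=> Ky /andP[ay yx]; apply: nv; exists y; split => //; rewrite yx andbT.
    rewrite ltNge; apply/negP => dy; have := loM _ Ky; lra.
  have xab : a <= x <= x by rewrite lexx ltW.
  have := fill_gaps_gap_continuous ax Kh Kx gap xab e0.
  apply: filterS2 (lt_nbhsr ax) => t tb + xt; apply.
  by rewrite xt ltW.
apply: filterS2 right left => t rt lt.
by have [/rt|/ltW/lt] := leP x t.
Qed.

End gap_filling.

(** Continuity of [phi] for the path metric is what makes this work: the paths inserted in gaps that
    shrink towards a point of [K] stay close to the image of that point. *)
Lemma path_metric_extension {R : realType} {Y : metricType R}
    (Yrc : rectifiably_connected Y) (K : set R)
    (phi : R -> path_metric_space Yrc) :
  compact K -> K !=set0 -> {within K, continuous phi} ->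
  exists gamma : R -> Y, continuous gamma /\ forall t, K t -> gamma t = phi t.
Proof.
move=> cK K0 cphi.
have clK : closed K by apply: compact_closed => //; exact: Rhausdorff.
have [M [_ MK]] := compact_bounded cK.
have {}MK x : K x -> `|x| <= M + 1 by move=> Kx; apply: MK => //; rewrite ltrDl.
have [||m Km mK] := closed_has_min clK; [by []| |].
  by exists (- (M + 1)) => x /MK; rewrite ler_norml => /andP[].
have [||m' Km' m'K] := closed_has_max clK; [by []| |].
  by exists (M + 1) => x /MK; rewrite ler_norml => /andP[].
pose cl t := Num.max m (Num.min t m').
have mm' : m <= m' by exact: mK.
have ccl : continuous cl by exact: continuous_clamp.
have clE t : K t -> cl t = t.
  by move=> Kt; rewrite /cl min_l ?max_r//; [exact: mK|exact: m'K].
(* Unlike K, the preimage K' of K under the retraction onto [min K, max K] is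
   unbounded on both sides, so every t lies between two points of K'. *)
pose K' := cl @^-1` K.
have clK' : closed K' by apply: preimage_closed clK => t _; exact: ccl.
have Klow t : t <= m -> K' t.
  by move=> tm; rewrite /K'/= /cl min_l ?(le_trans tm)// max_l.
have Khigh t : m' <= t -> K' t.
  by move=> tm; rewrite /K'/= /cl min_r// max_r.
have /choice[lo loP] t : exists x, [/\ K' x, x <= t &
    forall y, K' y -> y <= t -> y <= x].
  have [|||x [K'x xt] xM] := @closed_has_max R (K' `&` [set x | x <= t]).
  - by apply: closedI => //; exact: closed_le.
  - exists (Num.min m t); split => /=; last by rewrite ge_min lexx orbT.
    by apply: Klow; rewrite ge_min lexx.
  - by exists t => x [].
  by exists x; split => // y K'y yt; apply: xM.
have /choice[hi hiP] t : exists x, [/\ K' x, t <= x &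
    forall y, K' y -> t <= y -> x <= y].
  have [|||x [K'x xt] xM] := @closed_has_min R (K' `&` [set x | t <= x]).
  - by apply: closedI => //; exact: closed_ge.
  - exists (Num.max m' t); split => /=; last by rewrite le_max lexx orbT.
    by apply: Khigh; rewrite le_max lexx.
  - by exists t => x [].
  by exists x; split => // y K'y yt; apply: xM.
have /choice[pa paP] (yz : Y * Y) := short_path Yrc yz.1 yz.2.
have cphi' : {within K', continuous (phi \o cl)}.
  apply/subspace_continuousP => t K't.
  move/subspace_continuousP : cphi => /(_ _ K't) cphi; apply: cvg_comp cphi.
  move=> A nA; change (nbhs t (fun u => K' u -> A (cl u))).
  have nA' : nbhs t (fun u => K (cl u) -> A (cl u)) by exact: (ccl t _ nA).
  by apply: filterS nA' => u /= + K'u; apply.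
exists (fill_gaps (phi \o cl) (fun y z => pa (y, z)) lo hi); split.
  by apply: (fill_gaps_continuous cphi') => // y z; exact: (paP (y, z)).
move=> t Kt; have K't : K' t by rewrite /K'/= clE.
by rewrite (@fill_gaps_id _ _ _ K')//= ?clE// => y z; exact: (paP (y, z)).
Qed.

(** * Continuous images of the Cantor space *)

(** [phi] is the inverse of [e] followed by [psi]; it is continuous because a continuous map from a
    compact space to a Hausdorff space is closed. *)
Lemma cantor_range_factor {T S : topologicalType} (e : cantor_space -> T)
    (psi : cantor_space -> S) :
  hausdorff_space T -> continuous e -> injective e -> continuous psi ->
  exists phi : T -> S,
    {within range e, continuous phi} /\ forall c, phi (e c) = psi c.
Proof.
move=> hT ce ie cpsi.
pose phi x := psi (xget point [set c | e c = x]).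
have phiE c : phi (e c) = psi c.
  by congr psi; apply/ie/(@xgetPex _ point [set d | e d = e c]); exists c.
exists phi; split => //; apply/continuous_closedP => A cA.
apply/closed_subspaceP; exists (e @` (psi @^-1` A)).
  apply: compact_closed => //; apply: continuous_compact.
    exact: continuous_subspaceT.
  rewrite -[X in compact X]setTI; apply: compact_closedI.
    exact: cantor_space_compact.
  by move/continuous_closedP : cpsi; apply.
apply/seteqP; split => [_ [[c Ac <-] _]|_ [/[swap] [[c _ <-]]]] /=.
  by rewrite /from_subspace phiE; split => //; exists c.
by rewrite /from_subspace phiE => Ac; split; exists c.
Qed.

Lemma compact_metric_cantor_image {R : realType} (Z : metricType R) :
  [set: Z] !=set0 -> compact [set: Z] ->
  exists2 psi : cantor_space -> Z, continuous psi & forall z, range psi z.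
Proof.
move=> [z0 _] cZ.
(* The Alexandroff-Hausdorff theorem is applied to a pointed space, with base point [z0]. *)
pose T : pseudoPMetricType R := HB.pack (Metric.sort Z) (isPointed.Build Z z0).
have hT : hausdorff_space T by exact: (@metric_hausdorff R Z).
have [psi cpsi] := @cantor_surj R T cZ hT.
exists psi => // z; have [c _ cz] := 'surj_psi (I : [set: T] z).
by exists c.
Qed.

(** An instance of the construction above: the real line has no isolated points, and the identity
    serves as [h]. *)
Lemma cantor_embeddingR (R : realType) :
  exists2 kappa : cantor_space -> R, continuous kappa & injective kappa.
Proof.
have [||||||kappa [ckappa ikappa _ _ _]] :=
    @cantor_embedding R R^o id [set: R^o]; last by exists kappa.
- exact: locally_compactR.
- by [].
- by move=> e e0; exists e => // t /andP[].
- by exists 0.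
- exact: closedT.
- move=> x e _ e0; exists (x + e); split => //.
    by rewrite -subr_eq0 addrC addKr gt_eqF.
  by rewrite /mdist/= addrC addKr gtr0_norm.
Qed.

(** The curve is already onto on the compact set [range kappa], where it is [psi] after the inverse
    of [kappa]; this will make [f] onto on P' alone. *)
Lemma cantor_surjective_curve {R : realType} {Y : metricType R} :
  [set: Y] !=set0 -> length_compact Y ->
  exists (kappa : cantor_space -> R) (gamma : R -> Y),
    [/\ continuous kappa, continuous gamma &
        forall y, exists c, gamma (kappa c) = y].
Proof.
move=> Y0 [Yrc cY].
have [psi cpsi psiT] :=
  @compact_metric_cantor_image R (path_metric_space Yrc) Y0 cY.
have [kappa ckappa ikappa] := cantor_embeddingR R.
have [phi [cphi phiE]] := cantor_range_factor (@Rhausdorff R) ckappa ikappa cpsi.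
have cK : compact (range kappa).
  apply: continuous_compact; last exact: cantor_space_compact.
  exact: continuous_subspaceT.
have K0 : range kappa !=set0 by exists (kappa point), point.
have [gamma [cgamma gammaE]] := path_metric_extension cK K0 cphi.
exists kappa, gamma; split => // y; have [c _ cy] := psiT y.
by exists c; rewrite gammaE; [rewrite phiE|exists c].
Qed.

(** * Extension to [X] by Tietze's theorem *)

Theorem theorem9p1 (R : realType) (X : metricType R)
  (hX : locally_compact [set: X])
  (h : R -> R) (hh : hausdorff_function h) (h0 : h t @[t --> 0^'+] --> (0 : R))
  (Y : metricType R) (hY0 : [set: Y] !=set0) (hY : length_compact Y)
  (P : set X) (hP0 : P !=set0) (hP : perfect P) :
  exists (P' : set X) (f : X -> Y),
    [/\ compact P', perfect P' & P' `<=` P] /\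
    [/\ continuous f, f @` [set: X] = [set: Y],
        hausdorff_measure h P' = 0%E & f @` P' = [set: Y]].
Proof.
have [h_ge0 h_homo _ _] := hh.
have h_small e : 0 < e ->
    exists2 d, 0 < d & forall t, 0 <= t <= d -> h t <= e.
  move=> e0; have /cvgrPdist_lt/(_ _ e0) := h0.
  rewrite near_withinE => /nbhs_ballP[d /= d0 hd].
  have d20 : 0 < d / 2 by rewrite divr_gt0.
  (* The right-hand limit says nothing about the value at 0; the bound at [d / 2] and monotonicity
     cover 0 as well. *)
  exists (d / 2) => // t /andP[t0 td]; apply: le_trans (h_homo _ _ t0 td) _.
  have := hd (d / 2); rewrite /ball/= !sub0r !normrN gtr0_norm// => /(_ _ d20).
  by move=> hd2; apply/ltW/(le_lt_trans (ler_norm _))/hd2; lra.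
have P_nonisolated x e : P x -> 0 < e -> exists y, [/\ P y, y != x & mdist x y <= e].
  (* Otherwise the interior of the ball would meet [P] in [x] alone. *)
  move=> Px e0; apply: contrapT => noy.
  have [_ /(_ (ball x e)°)] := hP; apply.
  - exact: open_interior.
  - exists x; split => //; exact: nbhsx_ballx.
  apply: (@sub_finite_set _ _ [set x]); last exact: finite_set1.
  move=> y [/interior_subset]; rewrite ballEmdist/= => /ltW xy Py.
  by apply: contrapT => /eqP yx; apply: noy; exists y.
have [e [ce ie eP pe ne]] :=
  cantor_embedding hX h_ge0 h_small hP0 (proj1 hP) P_nonisolated.
have [kappa [gamma [ckappa cgamma surj]]] := cantor_surjective_curve hY0 hY.
have ceT : compact (range e).
  apply: continuous_compact; last exact: cantor_space_compact.
  exact: continuous_subspaceT.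
have [g0 [cg0 g0E]] := cantor_range_factor (@metric_hausdorff R X) ce ie ckappa.
have [M [_ MK]] : bounded_set (range kappa).
  apply: compact_bounded; apply: continuous_compact.
    exact: continuous_subspaceT.
  exact: cantor_space_compact.
(* Boundedness holds for every number exceeding [M], and Tietze's theorem asks for a positive bound;
   this number is both. *)
have M0 : 0 < `|M| + 1 by rewrite ltr_wpDl.
have g0M x : range e x -> `|g0 x| <= `|M| + 1.
  move=> [c _ <-]; rewrite g0E; apply: MK; last by exists c.
  by rewrite (le_lt_trans (ler_norm M))// ltrDl.
have [g [g0g cg _]] := continuous_bounded_extension
  (@pseudometric_normal R X) (proj1 pe) M0 cg0 g0M.
have fP : (gamma \o g) @` range e = [set: Y].
  apply/seteqP; split => // y _; have [c <-] := surj y.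
  exists (e c); first by exists c.
  by rewrite /= -g0g ?g0E// inE; exists c.
exists (range e), (gamma \o g); split; first by split.
split => //.
- by move=> x; apply: continuous_comp; [exact: cg|exact: cgamma].
- by apply/seteqP; split => // y; rewrite -fP => -[x _ <-]; exists x.
Qed.
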